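(* Let $v:L\to M$ be an isomorphism of finitely generated $R$-modules, where $L$ and $M$ are given with finite free presentations. Then, for almost all $\alpha$, the specialization $v_\alpha:L_\alpha\to M_\alpha$ is an isomorphism of $R_\alpha$-modules.
   Context: Let $k$ be an arbitrary infinite field, $u=(u_1,\ldots,u_m)$ and $x=(x_1,\ldots,x_n)$ indeterminates, and $R=k(u)[x]$. Let $K$ be an extension field of $k$; for $\alpha\in K^m$ put $R_\alpha=k(\alpha)[x]$. A property holds for almost all $\alpha$ if it holds for all $\alpha\in K^m$ except perhaps those lying on a proper algebraic subvariety of $K^m$ (which may depend on the given data). Every $a\in R$ can be written $a(u,x)=p(u,x)/q(u)$ with $p\in k[u,x]$, $q\in k[u]\setminus\{0\}$; for $\alpha$ with $q(\alpha)\neq 0$ put $a(\alpha,x)=p(\alpha,x)/q(\alpha)\in R_\alpha$. For a matrix $A=(a_{ij}(u,x))$ over $R$ put $A_\alpha=(a_{ij}(\alpha,x))$; this is defined for almost all $\alpha$. The specialization $F_\alpha$ of a free $R$-module $F$ of finite rank is a free $R_\alpha$-module of the same rank. With bases fixed, the specialization $\phi_\alpha:F_\alpha\to G_\alpha$ of a homomorphism $\phi:F\to G$ of free $R$-modules of finite ranks with matrix $A$ is the homomorphism with matrix $A_\alpha$. For a finitely generated $R$-module $L$ with a finite free presentation $F_1\xrightarrow{\phi}F_0\to L\to 0$ (free modules of finite ranks), the specialization is $L_\alpha:=\operatorname{Coker}\phi_\alpha$ (with respect to this presentation). For a homomorphism $v:L\to M$, with finite free presentations $F_1\xrightarrow{\phi}F_0\to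 L\to0$ and $G_1\xrightarrow{\psi}G_0\to M\to0$, choose lifts $v_0:F_0\to G_0$, $v_1:F_1\to G_1$ making the diagram of presentations commute. For almost all $\alpha$ one has $(v_0)_\alpha\phi_\alpha=\psi_\alpha(v_1)_\alpha$, and the specialization $v_\alpha:L_\alpha\to M_\alpha$ is the homomorphism induced by $(v_0)_\alpha$ on cokernels. *)

(* Defs.v *)
From HB Require Import structures.
From mathcomp Require Import all_boot all_order all_algebra.
From mathcomp Require Import boolp.
From mathcomp Require classical_sets cardinality.
From mathcomp Require Import mpoly.

Set Implicit Arguments.
Unset Strict Implicit.
Unset Printing Implicit Defensive.

Import GRing.Theory.
Local Open Scope ring_scope.
Local Open Scope quotient_scope.

(* The cokernel V / f(U), absent from the library as a module. *)
Section Coker.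
Variables (S : nzRingType) (U V : lmodType S) (f : {linear U -> V}).

Definition im : {pred V} := fun y => `[< exists x, y = f x >].

Lemma imP y : reflect (exists x, y = f x) (y \in im).
Proof. exact: asboolP. Qed.

Lemma im_zmod_closed : zmod_closed im.
Proof.
split; first by apply/imP; exists 0; rewrite linear0.
by move=> _ _ /imP[x ->] /imP[y ->]; apply/imP; exists (x - y); rewrite linearB.
Qed.

HB.instance Definition _ := GRing.isZmodClosed.Build V im im_zmod_closed.

Definition coker : Type := Quotient.quot im.

HB.instance Definition _ := Choice.on coker.
HB.instance Definition _ := GRing.Zmodule.on coker.

Definition coker_proj (y : V) : coker := \pi_(Quotient.quot im) y.
Definition coker_repr (z : coker) : V := repr (z : Quotient.quot im).

Lemma coker_reprK : cancel coker_repr coker_proj.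
Proof. exact: reprK. Qed.

Lemma coker_proj_eq y z : coker_proj y = coker_proj z <-> exists x, y - z = f x.
Proof.
rewrite /coker_proj; split.
  by move/eqP; rewrite -Quotient.idealrBE => /imP.
by move=> /imP yz; apply/eqP; rewrite -Quotient.idealrBE.
Qed.

Lemma coker_projD : {morph coker_proj : y z / y + z}.
Proof. by move=> y z; rewrite /coker_proj raddfD. Qed.

Definition coker_scale (a : S) (z : coker) : coker :=
  coker_proj (a *: coker_repr z).

Lemma coker_scale_proj a y : coker_scale a (coker_proj y) = coker_proj (a *: y).
Proof.
have /coker_proj_eq[x e] := coker_reprK (coker_proj y).
by apply/coker_proj_eq; exists (a *: x); rewrite -scalerBr e linearZ.
Qed.

Fact coker_scaleA a b z :
  coker_scale a (coker_scale b z) = coker_scale (a * b) z.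
Proof. by rewrite {2}/coker_scale coker_scale_proj scalerA. Qed.

Fact coker_scale1 : left_id 1 coker_scale.
Proof. by move=> z; rewrite /coker_scale scale1r coker_reprK. Qed.

Fact coker_scaleDr : right_distributive coker_scale +%R.
Proof.
move=> a y z; rewrite -[y]coker_reprK -[z]coker_reprK -coker_projD.
by rewrite !coker_scale_proj scalerDr coker_projD.
Qed.

Fact coker_scaleDl z : {morph coker_scale^~ z : a b / a + b}.
Proof. by move=> a b; rewrite /coker_scale scalerDl coker_projD. Qed.

HB.instance Definition _ := GRing.Zmodule_isLmodule.Build S coker
  coker_scaleA coker_scale1 coker_scaleDr coker_scaleDl.

Fact coker_proj_is_linear : linear coker_proj.
Proof. by move=> a y z; rewrite coker_projD -coker_scale_proj. Qed.

HB.instance Definition _ :=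
  GRing.isLinear.Build S V coker *:%R coker_proj coker_proj_is_linear.

End Coker.

Section CokerMap.
Variables (S : nzRingType) (U V U' V' : lmodType S).
Variables (f : {linear U -> V}) (g : {linear U' -> V'}).
Variables (h0 : {linear V -> V'}) (h1 : {linear U -> U'}).
Hypothesis comm : forall x, h0 (f x) = g (h1 x).

Definition coker_map of (forall x, h0 (f x) = g (h1 x)) :=
  fun z : coker f => coker_proj g (h0 (coker_repr z)).

Lemma coker_map_proj y :
  coker_map comm (coker_proj f y) = coker_proj g (h0 y).
Proof.
have /coker_proj_eq[x e] := coker_reprK (coker_proj f y).
by apply/coker_proj_eq; exists (h1 x); rewrite -comm -e linearB.
Qed.

Fact coker_map_is_linear : linear (coker_map comm).
Proof.
move=> a y z; rewrite -[y]coker_reprK -[z]coker_reprK -linearP.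
by rewrite !coker_map_proj -linearP -linearP.
Qed.

HB.instance Definition _ := GRing.isLinear.Build S (coker f) (coker g) *:%R
  (coker_map comm) coker_map_is_linear.

End CokerMap.

(* Free modules of finite rank with fixed bases are modules of column vectors;
   [mx_hom A] is the homomorphism x |-> A x with matrix A. *)
Definition mx_hom (S : comNzRingType) (p q : nat) (A : 'M[S]_(p, q)) :
    {linear 'cV[S]_q -> 'cV[S]_p} := mulmx A.

(* [A] presents [L] through the augmentation [eps]:
   S^q --A--> S^p --eps--> L --> 0 is exact. *)
Definition free_presentation (S : comNzRingType) (L : lmodType S) (p q : nat)
    (A : 'M[S]_(p, q)) (eps : {linear 'cV[S]_p -> L}) : Prop :=
  (forall l, exists y, l = eps y) /\
  (forall y, eps y = 0 <-> exists x, y = mx_hom A x).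

(* The proper algebraic subvarieties of K^m are the zero loci, other than K^m
   itself, of arbitrary sets of polynomials with coefficients in K. *)
Definition zero_locus (K : fieldType) (m : nat) (I : {mpoly K[m]} -> Prop)
    (alpha : 'I_m -> K) : Prop :=
  forall f, I f -> f.@[alpha] = 0.

Definition almost_all (K : fieldType) (m : nat) (P : ('I_m -> K) -> Prop) :=
  exists2 I : {mpoly K[m]} -> Prop,
    exists alpha, ~ zero_locus I alpha &
    forall alpha, ~ zero_locus I alpha -> P alpha.

(* The ring k(u)[x], with u = (u_0, ..., u_(m-1)) and x = (x_0, ..., x_(n-1)). *)
Notation Rux k m n := {mpoly {fraction {mpoly k[m]}}[n]}.

Section Specialization.
Variables (k K : fieldType) (iota : {rmorphism k -> K}) (m n : nat).
Implicit Types (p q : {mpoly k[m]}).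

Section Point.
Variable alpha : 'I_m -> K.

Definition adjoin_pred : {pred K} := fun z =>
  `[< exists pq : {mpoly k[m]} * {mpoly k[m]},
      mmap iota alpha pq.2 != 0 /\
      z = mmap iota alpha pq.1 / mmap iota alpha pq.2 >].

Lemma adjoinP z : reflect (exists pq : {mpoly k[m]} * {mpoly k[m]},
      mmap iota alpha pq.2 != 0 /\
      z = mmap iota alpha pq.1 / mmap iota alpha pq.2) (z \in adjoin_pred).
Proof. exact: asboolP. Qed.

Fact adjoin_divring_closed : divring_closed adjoin_pred.
Proof.
split.
- by apply/adjoinP; exists (1, 1); rewrite !rmorph1 divr1 oner_neq0.
- move=> _ _ /adjoinP[[a b] /= [b0 ->]] /adjoinP[[c d] /= [d0 ->]].
  apply/adjoinP; exists (a * d - c * b, b * d) => /=.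
  rewrite rmorphB !rmorphM /= mulf_neq0 //; split=> //.
  by rewrite -[in LHS]mulNr addf_div // mulNr.
- move=> _ _ /adjoinP[[a b] /= [b0 ->]] /adjoinP[[c d] /= [d0 ->]].
  have [c0|c0] := eqVneq (mmap iota alpha c) 0.
    apply/adjoinP; exists (0, 1) => /=.
    by rewrite c0 mul0r invr0 mulr0 rmorph0 mul0r rmorph1 oner_neq0.
  apply/adjoinP; exists (a * d, b * c) => /=.
  by rewrite !rmorphM /= mulf_neq0 // invf_div mulf_div.
Qed.

HB.instance Definition _ :=
  GRing.isDivringClosed.Build K adjoin_pred adjoin_divring_closed.

(* The subfield k(alpha) of K. *)
Definition adjoin : Type := {z : K | z \in adjoin_pred}.

HB.instance Definition _ := [isSub of adjoin for @sval K _].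
HB.instance Definition _ := [Choice of adjoin by <:].
HB.instance Definition _ := [SubChoice_isSubIntegralDomain of adjoin by <:].
HB.instance Definition _ := [SubIntegralDomain_isSubField of adjoin by <:].

Fact eval_subproof p : mmap iota alpha p \in adjoin_pred.
Proof.
by apply/adjoinP; exists (p, 1); rewrite !rmorph1 divr1 oner_neq0.
Qed.

(* [eval p] is the value p(alpha), as an element of k(alpha). *)
Definition eval p : adjoin := Sub (mmap iota alpha p) (eval_subproof p).

Fact eval_is_zmod_morphism : zmod_morphism eval.
Proof. by move=> p q; apply/val_inj; rewrite /= rmorphB. Qed.

Fact eval_is_monoid_morphism : monoid_morphism eval.
Proof. by split=> [|p q]; apply/val_inj; rewrite /= ?rmorph1 ?rmorphM. Qed.

HB.instance Definition _ :=
  GRing.isZmodMorphism.Build {mpoly k[m]} adjoin eval eval_is_zmod_morphism.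
HB.instance Definition _ :=
  GRing.isMonoidMorphism.Build {mpoly k[m]} adjoin eval eval_is_monoid_morphism.

(* [pq] stands for p(u, x) / q(u), with p in k[u, x] = k[u][x]. *)
Definition frac_of (pq : {mpoly {mpoly k[m]}[n]} * {mpoly k[m]}) : Rux k m n :=
  (FracField.tofrac pq.2)^-1 *: map_mpoly (@FracField.tofrac _) pq.1.

Definition frac_at (pq : {mpoly {mpoly k[m]}[n]} * {mpoly k[m]}) :
    {mpoly adjoin[n]} :=
  (eval pq.2)^-1 *: map_mpoly eval pq.1.

(* [a] has a representation p/q whose denominator does not vanish at alpha,
   that is, a(alpha, x) is defined. *)
Definition spec_defined (a : Rux k m n) : Prop :=
  exists pq, eval pq.2 != 0 /\ a = frac_of pq.

(* a(alpha, x), with the junk value 0 where it is undefined; by [specE] it does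
   not depend on the representation chosen. *)
Definition spec (a : Rux k m n) : {mpoly adjoin[n]} :=
  if pselect (spec_defined a) is left e then frac_at (projT1 (cid e)) else 0.

Fact mcoeff_frac_of (p : {mpoly {mpoly k[m]}[n]}) q d : (frac_of (p, q))@_d =
  FracField.tofrac p@_d / FracField.tofrac q.
Proof. by rewrite mcoeffZ mcoeff_map_mpoly mulrC. Qed.

Fact mcoeff_frac_at (p : {mpoly {mpoly k[m]}[n]}) q d : (frac_at (p, q))@_d = eval p@_d / eval q.
Proof. by rewrite mcoeffZ mcoeff_map_mpoly mulrC. Qed.

Lemma specE a pq : eval pq.2 != 0 -> a = frac_of pq -> spec a = frac_at pq.
Proof.
move=> q0 ->; rewrite /spec; case: pselect => [e|[]]; last by exists pq.
case: cid => -[p' q'] /= [q'0 /mpolyP E]; case: pq q0 E {e} => p q /= q0 E.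
have q1 : q != 0 by apply: contraNneq q0 => ->; rewrite rmorph0.
have q'1 : q' != 0 by apply: contraNneq q'0 => ->; rewrite rmorph0.
apply/mpolyP => d.
rewrite (mcoeff_frac_at p' q' d) (mcoeff_frac_at p q d).
have := etrans (esym (mcoeff_frac_of p q d))
  (etrans (E d) (mcoeff_frac_of p' q' d)).
move/eqP; rewrite eqr_div ?tofrac_eq0 // -!tofracM tofrac_eq => /eqP pq'.
by apply/eqP; rewrite eqr_div // -(rmorphM eval p'@_d q) -pq' rmorphM.
Qed.

Definition mx_spec_defined (r s : nat) (A : 'M[Rux k m n]_(r, s)) : Prop :=
  forall i j, spec_defined (A i j).

Definition mx_spec (r s : nat) (A : 'M[Rux k m n]_(r, s)) :
    'M[{mpoly adjoin[n]}]_(r, s) :=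
  map_mx spec A.

(* The specialization at alpha of the module presented by A. *)
Definition spec_mod (r s : nat) (A : 'M[Rux k m n]_(r, s)) :
    lmodType {mpoly adjoin[n]} := coker (mx_hom (mx_spec A)).

(* The specialization at alpha of a homomorphism with lifts V0, V1. *)
Definition spec_hom (p q p' q' : nat)
    (A : 'M[Rux k m n]_(p, q)) (B : 'M[Rux k m n]_(p', q'))
    (V0 : 'M[Rux k m n]_(p', p)) (V1 : 'M[Rux k m n]_(q', q))
    (comm : forall x, mx_hom (mx_spec V0) (mx_hom (mx_spec A) x) =
                      mx_hom (mx_spec B) (mx_hom (mx_spec V1) x)) :
    {linear spec_mod A -> spec_mod B} := coker_map comm.

End Point.
End Specialization.

(* Main.v *)
(* The inverse of v lifts to matrices w0, w1 between the presentations, and since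
   w0 v0 and v0 w0 induce identities on L and M, there are matrices s, t with
   w0 v0 = 1 + phi s and v0 w0 = 1 + psi t.  Off the zero set of a common
   denominator Q(u) of all the matrices involved, specialization is compatible
   with sums and products, so that these identities persist and w0 at alpha
   induces an inverse of v at alpha.  The exceptional set is a proper subvariety
   because Q, being nonzero, does not vanish at some point of k^m, k being
   infinite. *)
From HB Require Import structures.
Require Import Defs.
From mathcomp Require Import all_boot all_order all_algebra.
From mathcomp Require Import boolp.
From mathcomp Require Import mpoly.
From mathcomp Require classical_sets cardinality.
From mathcomp Require finmap.

Set Implicit Arguments.
Unset Strict Implicit.
Unset Printing Implicit Defensive.

Import GRing.Theory.

Local Open Scope ring_scope.
Local Open Scope quotient_scope.

(** * Points of nonvanishing over an infinite field *)

Section NonVanishing.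
Variable F : fieldType.
Hypothesis F_infinite : ~ cardinality.finite_set (@classical_sets.setT F).

Lemma poly_exists_nonroot (p : {poly F}) : p != 0 -> exists x, p.[x] != 0.
Proof.
move=> p0; apply/not_existsP => p_root.
(* All of the at least [size p] elements of [B] would be roots, while a nonzero [p] has fewer than
   [size p] roots. *)
have [B _ sB] := cardinality.infinite_set_fset (size p) F_infinite.
have : (size (finmap.enum_fset B) < size p)%N.
  apply: max_poly_roots => //; last exact: finmap.fset_uniq.
  by apply/allP => x _; apply/negPn/negP; apply: p_root.
by rewrite ltnNge sB.
Qed.

(** [muni] separates off the last variable; through this identity a nonzero coefficient of [p]
    yields a nonzero coefficient of [muni p]. *)
Lemma mcoeff_muni (R : nzRingType) n (p : {mpoly R[n.+1]}) (d : 'X_{1..n.+1}) :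
  (muni p)`_(d ord_max)@_[multinom d (widen_ord (leqnSn n) i) | i < n] = p@_d.
Proof.
rewrite muniE coef_sum raddf_sum /= [in RHS](mpolyE p) raddf_sum /=.
apply: eq_bigr => e _; rewrite coefZ coefXn -scalerAl !mcoeffZ mcoeffX.
congr (_ * _).
case: (e =P d) => [->|ne_ed]; first by rewrite eqxx mulr1 mcoeffX eqxx.
case: eqP => [ed|_]; last by rewrite mulr0 mcoeff0.
rewrite mulr1 mcoeffX; case: eqP => // /mnmP E; case: ne_ed.
apply/mnmP => i; case: (unliftP ord_max i) => [j ->|-> //].
have := E j; rewrite !mnmE.
by have -> : lift ord_max j = widen_ord (leqnSn n) j by apply/val_inj/lift_max.
Qed.

Lemma meval_muni (R : comNzRingType) n (p : {mpoly R[n.+1]}) (v : 'I_n.+1 -> R) :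
  p.@[v] =
  (map_poly (meval (v \o widen_ord (leqnSn n))) (muni p)).[v ord_max].
Proof.
rewrite muniE mevalE rmorph_sum /= horner_sum; apply: eq_bigr => e _.
rewrite map_polyZ /= map_polyXn hornerZ hornerXn.
rewrite mevalZ mevalX -mulrA; congr (_ * _).
rewrite big_ord_recr /=; congr (_ * _).
by apply: eq_bigr => i _; rewrite mnmE.
Qed.

Lemma mpoly_exists_nonzero n (p : {mpoly F[n]}) :
  p != 0 -> exists v, p.@[v] != 0.
Proof.
elim: n p => [|n IHn] p p0.
  exists (fun=> 0); apply: contraNneq p0 => pv.
  apply/eqP/mpolyP => d.
  have pC : p = (p@_0%MM)%:MP.
    apply/mpolyP => e; rewrite mcoeffC.
    by have -> : e = 0%MM by [apply/mnmP; case]; rewrite eqxx mulr1.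
  by move: pv; rewrite pC mevalC => ->; rewrite mpolyC0.
have [d pd0] : exists d, p@_d != 0.
  by exists (mlead p); rewrite mleadc_eq0.
(* The induction hypothesis applies to this coefficient, which lacks the last variable; with the
   other variables set to [w], a nonzero univariate polynomial remains. *)
have [w w0] : exists w, ((muni p)`_(d ord_max)).@[w] != 0.
  by apply: IHn; apply: contraNneq pd0 => c0; rewrite -mcoeff_muni c0 mcoeff0.
have [|x x0] := @poly_exists_nonroot (map_poly (meval w) (muni p)).
  by apply: contraNneq w0 => q0; rewrite -coef_map q0 coef0.
exists (fun i => if unlift ord_max i is Some j then w j else x).
rewrite meval_muni unlift_none.
suff -> : (fun i => if unlift ord_max i is Some j then w j else x)
            \o widen_ord (leqnSn n) = w by [].
apply/funext => j /=.
have -> : widen_ord (leqnSn n) j = lift ord_max j.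
  by apply/val_inj/esym/lift_max.
by rewrite liftK.
Qed.

End NonVanishing.

(** The subvariety is the hypersurface of [Q] transported to K. It is proper because [iota] is
    injective and so maps a point of k^m where [Q] does not vanish to a point off it. *)
Lemma almost_all_nonvanishing (k K : fieldType) (iota : {rmorphism k -> K})
    (m : nat) (P : ('I_m -> K) -> Prop) (Q : {mpoly k[m]}) :
  ~ cardinality.finite_set (@classical_sets.setT k) -> Q != 0 ->
  (forall alpha, eval iota alpha Q != 0 -> P alpha) -> almost_all P.
Proof.
move=> k_infinite Q0 QP.
have evalQ alpha : (map_mpoly iota Q).@[alpha] = mmap iota alpha Q.
  rewrite mevalE (perm_big _ (msupp_map_mpoly _ (fmorph_inj iota))) /=.
  by apply: eq_bigr => d _; rewrite mcoeff_map_mpoly.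
exists (fun f => f = map_mpoly iota Q).
  have [v v0] := mpoly_exists_nonzero k_infinite Q0.
  exists (iota \o v) => /(_ _ erefl) /eqP; rewrite evalQ.
  suff -> : mmap iota (iota \o v) Q = iota Q.@[v] by rewrite fmorph_eq0 (negPf v0).
  rewrite /mmap mevalE rmorph_sum; apply: eq_bigr => d _.
  rewrite rmorphM rmorph_prod; congr (_ * _).
  by apply: eq_bigr => i _; rewrite rmorphXn.
move=> alpha Qalpha; apply: QP; apply: contra_notN Qalpha => /eqP Qalpha f ->.
by rewrite evalQ; have := congr1 val Qalpha.
Qed.

(* Both [frac_of] and [frac_at alpha] are instances of this construction, for
   the embedding of k[u] in k(u) and for the evaluation at alpha. *)
Section FracMap.
Variables (A : comNzRingType) (F : fieldType) (g : {rmorphism A -> F}) (n : nat).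
Implicit Types pq : {mpoly A[n]} * A.

Definition frac_map pq : {mpoly F[n]} := (g pq.2)^-1 *: map_mpoly g pq.1.

Definition frac_add pq pq' := (pq'.2 *: pq.1 + pq.2 *: pq'.1, pq.2 * pq'.2).
Definition frac_mul pq pq' := (pq.1 * pq'.1, pq.2 * pq'.2).

Lemma frac_mapD pq pq' : g pq.2 != 0 -> g pq'.2 != 0 ->
  frac_map (frac_add pq pq') = frac_map pq + frac_map pq'.
Proof.
move=> q0 q'0; rewrite /frac_map rmorphD /= !map_mpolyZ scalerDr !scalerA.
by rewrite rmorphM invfM mulfVK // mulrAC mulVf // mul1r.
Qed.

Lemma frac_mapM pq pq' :
  frac_map (frac_mul pq pq') = frac_map pq * frac_map pq'.
Proof. by rewrite /frac_map !rmorphM /= invfM -scalerAl -scalerAr scalerA. Qed.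

Lemma frac_mapC (a : A) : frac_map (a%:MP, 1) = (g a)%:MP.
Proof. by rewrite /frac_map rmorph1 invr1 scale1r map_mpolyC. Qed.

End FracMap.

Lemma fraction_divP (R : idomainType) (c : {fraction R}) :
  exists x, exists2 y, y != 0 & c = FracField.tofrac x / FracField.tofrac y.
Proof.
elim/quotW: c => r; exists \n_r, \d_r; first exact: denom_ratioP.
apply: (canRL (mulfK _)); first by rewrite tofrac_eq0 denom_ratioP.
(* Unfolding the product of classes reduces the equality in the quotient to cross-multiplication. *)
rewrite /GRing.mul /= !piE; apply/eqmodP; rewrite /= FracField.equivfE.
by rewrite /FracField.mulf !numden_Ratio ?oner_neq0 ?mulr1 ?denom_ratioP // mulrC.
Qed.

(** * Compatibility of specialization with matrix operations *)

Section Specialization.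
Variables (k K : fieldType) (iota : {rmorphism k -> K}) (m n : nat).

(** Monomial by monomial, the denominator of the new coefficient is multiplied into the common
    one. *)
Lemma frac_of_surj (a : Rux k m n) :
  exists2 pq, pq.2 != 0 & a = frac_of pq.
Proof.
elim/mpolyind: a => [|c d a _ _ [pq q0 ->]].
  by exists (0, 1); rewrite ?oner_neq0 // /frac_of raddf0 scaler0.
have [x [y y0 ->]] := fraction_divP c.
pose pq' : {mpoly {mpoly k[m]}[n]} * {mpoly k[m]} := (x *: 'X_[d], y).
exists (frac_add pq' pq); first by rewrite mulf_neq0.
have -> : (FracField.tofrac x / FracField.tofrac y) *: 'X_[d] = frac_of pq'.
  by rewrite /frac_of /= map_mpolyZ map_mpolyX scalerA mulrC.
by symmetry; apply: frac_mapD; rewrite tofrac_eq0.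
Qed.

Section Point.
Variable alpha : 'I_m -> K.

Local Notation spec := (@spec k K iota m n alpha).
Local Notation mx_spec := (mx_spec iota alpha).

(* Phrasing the compatibility with + and * for a relation rather than for [spec]
   carries the definedness conditions along, so that [big_ind2] applies. *)
Definition spec_to (a : Rux k m n) b :=
  exists2 pq, eval iota alpha pq.2 != 0 &
    a = frac_of pq /\ b = frac_at iota alpha pq.

Lemma spec_toE a b : spec_to a b -> spec a = b.
Proof. by move=> [pq q0 [aE ->]]; apply: specE. Qed.

Lemma spec_to_spec a : spec_defined iota alpha a -> spec_to a (spec a).
Proof. by move=> [pq [q0 aE]]; exists pq => //; split=> //; apply: specE. Qed.

Lemma eval_tofrac_neq0 (q : {mpoly k[m]}) :
  eval iota alpha q != 0 -> FracField.tofrac q != 0.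
Proof.
by rewrite tofrac_eq0; apply: contraNneq => ->; rewrite raddf0.
Qed.

Lemma spec_toD a b a' b' : spec_to a b -> spec_to a' b' -> spec_to (a + a') (b + b').
Proof.
move=> [pq q0 [-> ->]] [pq' q'0 [-> ->]]; exists (frac_add pq pq').
  by rewrite rmorphM mulf_neq0.
by split; symmetry; apply: frac_mapD => //; apply: eval_tofrac_neq0.
Qed.

Lemma spec_toM a b a' b' : spec_to a b -> spec_to a' b' -> spec_to (a * a') (b * b').
Proof.
move=> [pq q0 [-> ->]] [pq' q'0 [-> ->]]; exists (frac_mul pq pq').
  by rewrite rmorphM mulf_neq0.
by split; symmetry; apply: frac_mapM.
Qed.

(** Serves for the empty sum in a matrix product and for the entries 0 and 1 of the identity
    matrix. *)
Lemma spec_to_nat i : spec_to i%:R i%:R.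
Proof.
exists (i%:R%:MP, 1); first by rewrite rmorph1 oner_neq0.
split; symmetry; apply: (etrans (frac_mapC _ _ _)).
  by rewrite !rmorph_nat.
by rewrite !rmorph_nat.
Qed.

Lemma mx_specM r s t (A : 'M[Rux k m n]_(r, s)) (B : 'M[Rux k m n]_(s, t)) :
  mx_spec_defined iota alpha A -> mx_spec_defined iota alpha B ->
  mx_spec (A *m B) = mx_spec A *m mx_spec B.
Proof.
move=> dA dB; apply/matrixP => i j; rewrite !mxE; apply: spec_toE.
apply: (big_ind2 spec_to); [exact: (spec_to_nat 0)|exact: spec_toD|].
by move=> l _; rewrite !mxE; apply: spec_toM; apply: spec_to_spec.
Qed.

(** This is the shape of the relations that make two lifts mutually inverse on cokernels. *)
Lemma mx_spec_1DM r s (A : 'M[Rux k m n]_(r, s)) (B : 'M[Rux k m n]_(s, r)) :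
  mx_spec_defined iota alpha A -> mx_spec_defined iota alpha B ->
  mx_spec (1%:M + A *m B) = 1%:M + mx_spec A *m mx_spec B.
Proof.
move=> dA dB; apply/matrixP => i j; rewrite !mxE; apply: spec_toE.
apply: spec_toD; first exact: spec_to_nat.
apply: (big_ind2 spec_to); [exact: (spec_to_nat 0)|exact: spec_toD|].
by move=> l _; rewrite !mxE; apply: spec_toM; apply: spec_to_spec.
Qed.

End Point.

Lemma mx_spec_defined_generic r s (A : 'M[Rux k m n]_(r, s)) :
  exists2 Q : {mpoly k[m]}, Q != 0 &
  forall alpha, eval iota alpha Q != 0 -> mx_spec_defined iota alpha A.
Proof.
have /choice[f fP] : forall ij : 'I_r * 'I_s,
    exists pq, pq.2 != 0 /\ A ij.1 ij.2 = frac_of pq.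
  by move=> ij; have [pq ? ?] := frac_of_surj (A ij.1 ij.2); exists pq.
(* One chosen denominator per entry: where the product does not vanish, no factor does. *)
exists (\prod_ij (f ij).2); first by apply/prodf_neq0 => ij _; case: (fP ij).
move=> alpha; rewrite rmorph_prod => /prodf_neq0 f0 i j.
by exists (f (i, j)); split; [apply: f0|case: (fP (i, j))].
Qed.

End Specialization.

(** * Matrices lifting maps between presented modules *)

Lemma mx_homE (S : comNzRingType) (a b : nat) (A : 'M[S]_(a, b)) x :
  mx_hom A x = A *m x.
Proof. by []. Qed.

(** Projectivity of free modules: the columns of [W] are chosen preimages under [g] of the values of
    [f] on the standard basis. *)
Lemma lift_mx (S : comNzRingType) (N : lmodType S) (a b : nat)
    (f : {linear 'cV[S]_a -> N}) (g : {linear 'cV[S]_b -> N}) :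
  (forall y, exists x, f y = g x) ->
  exists W : 'M[S]_(b, a), forall y, f y = g (mx_hom W y).
Proof.
move=> fg.
have /choice[h hP] : forall j : 'I_a, exists x, f (delta_mx j 0) = g x.
  by move=> j; apply: fg.
exists (\matrix_(i, j) h j i 0) => y.
have -> : mx_hom (\matrix_(i, j) h j i 0) y = \sum_j y j 0 *: h j.
  apply/matrixP => i l; rewrite !mxE summxE (ord1 l).
  by apply: eq_bigr => j _; rewrite !mxE mulrC.
rewrite linear_sum [y in LHS]matrix_sum_delta linear_sum.
by apply: eq_bigr => j _; rewrite big_ord1 !linearZ /= hP.
Qed.

Lemma mx_hom_inj (S : comNzRingType) (a b : nat) (A B : 'M[S]_(a, b)) :
  (forall y, mx_hom A y = mx_hom B y) -> A = B.
Proof.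
move=> AB; apply/matrixP => i j; have /matrixP/(_ i 0) := AB (delta_mx j 0).
by rewrite !mx_homE -!colE !mxE.
Qed.

(** The inverse is induced by [l0]: both composites differ from the identity by elements of the
    images of [f] and [g], which vanish in the quotients. *)
Lemma coker_map_bij (S : nzRingType) (U V U' V' : lmodType S)
    (f : {linear U -> V}) (g : {linear U' -> V'})
    (h0 : {linear V -> V'}) (h1 : {linear U -> U'})
    (l0 : {linear V' -> V}) (l1 : {linear U' -> U})
    (hP : forall x, h0 (f x) = g (h1 x)) :
  (forall x, l0 (g x) = f (l1 x)) ->
  (forall y, exists x, l0 (h0 y) - y = f x) ->
  (forall y, exists x, h0 (l0 y) - y = g x) ->
  bijective (coker_map hP).
Proof.
move=> lP lh hl; exists (coker_map lP) => z.
  rewrite -[z]coker_reprK !coker_map_proj; exact/coker_proj_eq.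
rewrite -[z]coker_reprK !coker_map_proj; exact/coker_proj_eq.
Qed.

Lemma mx_coker_map_bij (S : comNzRingType) (p q p' q' : nat)
    (A : 'M[S]_(p, q)) (B : 'M[S]_(p', q'))
    (V0 : 'M[S]_(p', p)) (V1 : 'M[S]_(q', q))
    (W0 : 'M[S]_(p, p')) (W1 : 'M[S]_(q, q'))
    (X : 'M[S]_(q, p)) (Y : 'M[S]_(q', p'))
    (comm : forall x, mx_hom V0 (mx_hom A x) = mx_hom B (mx_hom V1 x)) :
  W0 *m B = A *m W1 -> W0 *m V0 = 1%:M + A *m X ->
  V0 *m W0 = 1%:M + B *m Y -> bijective (coker_map comm).
Proof.
move=> WB WV VW.
apply: (@coker_map_bij _ _ _ _ _ _ _ _ _ (mx_hom W0) (mx_hom W1)) => y.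
- by rewrite !mx_homE !mulmxA WB.
- exists (mx_hom X y).
  by rewrite !mx_homE !mulmxA WV mulmxDl mul1mx addrC addKr.
- exists (mx_hom Y y).
  by rewrite !mx_homE !mulmxA VW mulmxDl mul1mx addrC addKr.
Qed.

Theorem proposition2p2 (k K : fieldType) (iota : {rmorphism k -> K})
    (k_infinite : ~ cardinality.finite_set (@classical_sets.setT k))
    (m n : nat)
    (L M : lmodType (Rux k m n))
    (p q p' q' : nat)
    (phi : 'M[Rux k m n]_(p, q)) (epsL : {linear 'cV[Rux k m n]_p -> L})
    (psi : 'M[Rux k m n]_(p', q')) (epsM : {linear 'cV[Rux k m n]_p' -> M})
    (presL : free_presentation phi epsL) (presM : free_presentation psi epsM)
    (v : {linear L -> M}) (v_iso : bijective v)
    (v0 : 'M[Rux k m n]_(p', p)) (v1 : 'M[Rux k m n]_(q', q))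
    (v0_lift : forall y, epsM (mx_hom v0 y) = v (epsL y))
    (v1_lift : forall x, mx_hom v0 (mx_hom phi x) = mx_hom psi (mx_hom v1 x)) :
  almost_all (fun alpha : 'I_m -> K =>
    [/\ mx_spec_defined iota alpha phi, mx_spec_defined iota alpha psi,
        mx_spec_defined iota alpha v0, mx_spec_defined iota alpha v1 &
        exists comm : forall x,
            mx_hom (mx_spec iota alpha v0) (mx_hom (mx_spec iota alpha phi) x) =
            mx_hom (mx_spec iota alpha psi) (mx_hom (mx_spec iota alpha v1) x),
          bijective (spec_hom comm)]).
Proof.
have [w wK vK] := v_iso.
have w_lin : linear w := can2_linear wK vK.
(* Bundling the inverse as a linear map lets its composite with [epsM] be lifted. *)
pose wHB := GRing.isLinear.Build _ _ _ _ w w_lin.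
pose wL : {linear M -> L} := HB.pack w wHB.
have [epsL_surj kerL] := presL; have [epsM_surj kerM] := presM.
have [w0 w0P] : exists w0 : 'M_(p, p'), forall y,
    w (epsM y) = epsL (mx_hom w0 y).
  by apply: (@lift_mx _ _ _ _ (wL \o epsM)) => y; apply: epsL_surj.
(* By [w0P], [epsL] sends [w0 psi y] to [w (epsM (psi y))], which is 0; exactness then gives a
   factorization through [phi]. *)
have [w1 w1P] : exists w1 : 'M_(q, q'), forall y,
    mx_hom (w0 *m psi) y = mx_hom phi (mx_hom w1 y).
  apply: lift_mx => y; apply/kerL.
  have -> : mx_hom (w0 *m psi) y = mx_hom w0 (mx_hom psi y) by rewrite !mx_homE mulmxA.
  rewrite -w0P (_ : epsM _ = 0); first exact: (linear0 wL).
  by apply/kerM; exists y.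
(* [epsL] kills the image of [w0 v0 - 1] because [w] inverts [v]. *)
have [s sP] : exists s : 'M_(q, p), forall y,
    mx_hom (w0 *m v0 - 1%:M) y = mx_hom phi (mx_hom s y).
  apply: lift_mx => y; apply/kerL.
  have -> : mx_hom (w0 *m v0 - 1%:M) y = mx_hom w0 (mx_hom v0 y) - y.
    by rewrite !mx_homE mulmxBl mul1mx mulmxA.
  by rewrite linearB /= -w0P v0_lift wK subrr.
have [t tP] : exists t : 'M_(q', p'), forall y,
    mx_hom (v0 *m w0 - 1%:M) y = mx_hom psi (mx_hom t y).
  apply: lift_mx => y; apply/kerM.
  have -> : mx_hom (v0 *m w0 - 1%:M) y = mx_hom v0 (mx_hom w0 y) - y.
    by rewrite !mx_homE mulmxBl mul1mx mulmxA.
  by rewrite linearB /= v0_lift -w0P vK subrr.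
(* Equalities tested on vectors over R become matrix identities, which can be specialized entry by
   entry. *)
have v1E : v0 *m phi = psi *m v1.
  by apply: mx_hom_inj => y; have := v1_lift y; rewrite !mx_homE !mulmxA.
have w1E : w0 *m psi = phi *m w1.
  by apply: mx_hom_inj => y; rewrite w1P !mx_homE mulmxA.
have sE : w0 *m v0 = 1%:M + phi *m s.
  apply/eqP; rewrite addrC -subr_eq; apply/eqP.
  by apply: mx_hom_inj => y; rewrite sP !mx_homE mulmxA.
have tE : v0 *m w0 = 1%:M + psi *m t.
  apply/eqP; rewrite addrC -subr_eq; apply/eqP.
  by apply: mx_hom_inj => y; rewrite tP !mx_homE mulmxA.
have [Qphi Qphi0 dphi] := mx_spec_defined_generic iota phi.
have [Qpsi Qpsi0 dpsi] := mx_spec_defined_generic iota psi.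
have [Qv0 Qv00 dv0] := mx_spec_defined_generic iota v0.
have [Qv1 Qv10 dv1] := mx_spec_defined_generic iota v1.
have [Qw0 Qw00 dw0] := mx_spec_defined_generic iota w0.
have [Qw1 Qw10 dw1] := mx_spec_defined_generic iota w1.
have [Qs Qs0 ds] := mx_spec_defined_generic iota s.
have [Qt Qt0 dt] := mx_spec_defined_generic iota t.
(* The denominators of the auxiliary [w0], [w1], [s], [t] enter as well, so that the inverse and its
   relations specialize too. *)
apply: (@almost_all_nonvanishing _ _ iota _ _
  (\prod_(Q <- [:: Qphi; Qpsi; Qv0; Qv1; Qw0; Qw1; Qs; Qt]) Q)) => //.
  by rewrite !big_cons big_nil !mulf_neq0 ?oner_neq0.
move=> alpha; rewrite !big_cons big_nil !rmorphM /= rmorph1 mulr1 !mulf_eq0 !negb_or.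
move=> /and5P[/dphi {}dphi /dpsi {}dpsi /dv0 {}dv0 /dv1 {}dv1].
move=> /and4P[/dw0 {}dw0 /dw1 {}dw1 /ds {}ds /dt {}dt].
have comm : mx_spec iota alpha v0 *m mx_spec iota alpha phi
          = mx_spec iota alpha psi *m mx_spec iota alpha v1.
  by rewrite -!mx_specM // v1E.
have commw : mx_spec iota alpha w0 *m mx_spec iota alpha psi
           = mx_spec iota alpha phi *m mx_spec iota alpha w1.
  by rewrite -!mx_specM // w1E.
have w0v0 : mx_spec iota alpha w0 *m mx_spec iota alpha v0
          = 1%:M + mx_spec iota alpha phi *m mx_spec iota alpha s.
  by rewrite -mx_specM // sE mx_spec_1DM.
have v0w0 : mx_spec iota alpha v0 *m mx_spec iota alpha w0
          = 1%:M + mx_spec iota alpha psi *m mx_spec iota alpha t.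
  by rewrite -mx_specM // tE mx_spec_1DM.
have commx x : mx_hom (mx_spec iota alpha v0) (mx_hom (mx_spec iota alpha phi) x)
    = mx_hom (mx_spec iota alpha psi) (mx_hom (mx_spec iota alpha v1) x).
  by rewrite !mx_homE !mulmxA comm.
split=> //; exists commx.
exact: (mx_coker_map_bij commx commw w0v0 v0w0).
Qed.
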